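(* Let $X$ be an $n$-dimensional normed space with unit ball $B$, and let $H_1\subset\dots\subset H_{n-1}$ be linear subspaces of dimensions $1,\dots,n-1$, respectively. If $X$ has the $(H_1,\dots,H_{n-1})$-2-intersection property, then $e(X)\geq n+1$, i.e. there exist $n+1$ points of $X$ that are pairwise equidistant (at a common positive distance) in the norm of $X$.
   Context: Throughout, $X$ is identified with $\mathbb{R}^n$ endowed with a norm $\|\cdot\|$, and $B=\{x:\|x\|\le 1\}$ is its unit ball, a $0$-symmetric convex compact set with nonempty interior. The equilateral dimension $e(X)$ is the maximum number of pairwise equidistant points in $X$. The diameter of $A\subset X$ is $\mathrm{D}(A)=\sup_{x,y\in A}\|x-y\|$. A simplex is equilateral if all its edges have the same length measured in $\|\cdot\|$. A simplex $S$ is inscribed in a convex compact set $K$ if $S\subset K$ and all vertices of $S$ belong to the boundary of $K$; when $K$ is a section $B\cap(te_i+H_{i-1})$, the boundary is taken relative to the affine subspace $te_i+H_{i-1}$. Let $H_1\subset\dots\subset H_{n-1}$ be linear subspaces of $\mathbb{R}^n$ of dimensions $1,\dots,n-1$, and put $H_n=\mathbb{R}^n$. Intersection property: $B$ has the $(H_1,\dots,H_{n-1})$ intersection property if, for every $i=1,\dots,n-1$ and every $x\in\mathbb{R}^n$ with $B\cap(x+H_i)\neq\emptyset$, the section $B\cap(x+H_i)$ is homothetic to $B\cap H_i$, i.e. $B\cap(x+H_i)=v+\lambda(B\cap H_i)$ for some $v\in\mathbb{R}^n$ and $\lambda\ge 0$ (single-point sections, $\lambda=0$, are allowed). 2-intersection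 property: after a suitable rotation, suppose $H_i=\langle e_1,\dots,e_i\rangle$ for $i=1,\dots,n-1$, where $e_1,\dots,e_n$ is the canonical basis. (Equivalently, let $e_1,\dots,e_n$ be a Euclidean-orthonormal basis of $\mathbb{R}^n$ with $H_i=\langle e_1,\dots,e_i\rangle$ for all $i$.) Then $B$ has the $(H_1,\dots,H_{n-1})$-2-intersection property if it has the $(H_1,\dots,H_{n-1})$ intersection property and, for every $i=2,\dots,n$, the following holds: whenever $S_{i-1}$ is an $(i-1)$-dimensional equilateral simplex with $\mathrm{D}(S_{i-1})=1$ that is inscribed in $B\cap(te_i+H_{i-1})$ for some $t>0$, then $(B\cap H_i)\cap(2te_i+H_{i-1})=\emptyset$. The space $X$ is said to have the $(H_1,\dots,H_{n-1})$-2-intersection property if its unit ball $B$ has it. *)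

(* Defs.v *)
From HB Require Import structures.
From mathcomp Require Import all_boot all_order all_algebra.
From mathcomp Require Import all_classical all_reals all_analysis.

Set Implicit Arguments.
Unset Strict Implicit.
Unset Printing Implicit Defensive.

Import Order.TTheory GRing.Theory Num.Theory.
Import numFieldNormedType.Exports.

Local Open Scope classical_set_scope.
Local Open Scope ring_scope.

(* The library norm on 'rV[R]_n is the max norm, so the norm of X is a function
   N, while the topology of R^n (which does not depend on N) is the library's. *)
Record is_norm (R : realType) (n : nat) (N : 'rV[R]_n -> R) : Prop := IsNorm {
  is_norm_triangle : forall x y, N (x + y) <= N x + N y;
  is_norm_scale : forall (a : R) x, N (a *: x) = `|a| * N x;
  is_norm_eq0 : forall x, N x = 0 -> x = 0 }.

Section Definitions.
Variables (R : realType) (n : nat).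
Local Notation V := 'rV[R]_n.
Implicit Types (N : V -> R) (x : V) (A K : set V).

Definition unit_ball N : set V := [set x | N x <= 1].

Definition vset (U : {vspace V}) : set V := [set x | x \in U].

Definition translate x (U : {vspace V}) : set V := [set x + u | u in vset U].

Definition dot (u v : V) : R := \sum_(k < n) u 0 k * v 0 k.

Definition diam N A : R := sup [set N (z.1 - z.2) | z in A `*` A].

Definition equidistant N (m : nat) (p : 'I_m -> V) : Prop :=
  exists2 c : R, 0 < c & forall j k, j != k -> N (p j - p k) = c.

(* The maximum is taken in the extended reals, so that the supremum is
   meaningful without proving first that the set is bounded. *)
Definition equilateral_dim N : \bar R :=
  ereal_sup [set (m%:R)%:E | m in
    [set m : nat | exists p : 'I_m -> V, equidistant N p]].

Definition affinely_independent (m : nat) (p : 'I_m.+1 -> V) : Prop :=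
  free [seq p (lift ord0 k) - p ord0 | k <- enum 'I_m].

Definition convex_hull (m : nat) (p : 'I_m -> V) : set V :=
  [set \sum_(k < m) l k *: p k | l in
    [set l : 'I_m -> R | (forall k, 0 <= l k) /\ \sum_(k < m) l k = 1]].

Definition rel_boundary A K : set V :=
  @closure (subspace A) K `\` @interior (subspace A) K.

(* p is the family of vertices of the simplex. *)
Definition inscribed A K (m : nat) (p : 'I_m -> V) : Prop :=
  convex_hull p `<=` K /\ forall k, rel_boundary A K (p k).

(* H_i is H i, for 1 <= i <= n - 1; the other values of H are never used. *)
Definition is_flag (H : nat -> {vspace V}) : Prop :=
  (forall i, (0 < i < n)%N -> \dim (H i) = i) /\
  (forall i j, (0 < i)%N -> (i <= j)%N -> (j < n)%N -> (H i <= H j)%VS).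

Definition flag_ext (H : nat -> {vspace V}) (i : nat) : {vspace V} :=
  if i == n then fullv else H i.

Definition intersection_property N (H : nat -> {vspace V}) : Prop :=
  forall i x, (0 < i < n)%N ->
    unit_ball N `&` translate x (H i) !=set0 ->
    exists (v : V) (lam : R), 0 <= lam /\
      unit_ball N `&` translate x (H i) =
      [set v + lam *: y | y in unit_ball N `&` vset (H i)].

(* e_i is e i, for 1 <= i <= n; the other values of e are never used. *)
Definition adapted_basis (H : nat -> {vspace V}) (e : nat -> V) : Prop :=
  (forall i j, (0 < i <= n)%N -> (0 < j <= n)%N ->
     dot (e i) (e j) = (i == j)%:R) /\
  (forall i, (0 < i < n)%N -> H i = <<[seq e j | j <- iota 1 i]>>%VS).

(* Each e i is determined by H up to its sign, and the last clause is
   insensitive to these signs because the unit ball is symmetric; so it does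
   not matter which adapted basis is used. *)
Definition two_intersection_property N (H : nat -> {vspace V}) : Prop :=
  intersection_property N H /\
  exists2 e : nat -> V, adapted_basis H e &
    forall i, (1 < i <= n)%N ->
    forall (t : R) (p : 'I_i.-1.+1 -> V), 0 < t ->
      affinely_independent p ->
      equidistant N p ->
      diam N (convex_hull p) = 1 ->
      inscribed (translate (t *: e i) (H i.-1))
        (unit_ball N `&` translate (t *: e i) (H i.-1)) p ->
      (unit_ball N `&` vset (flag_ext H i)) `&`
        translate ((2 * t) *: e i) (H i.-1) = set0.

End Definitions.

(* Main.v *)
Require Import Defs.
From HB Require Import structures.
From mathcomp Require Import all_boot all_order all_algebra.
From mathcomp Require Import all_classical all_reals all_analysis.
From mathcomp Require Import ring lra.

(* Induct on the dimension i, carrying an equilateral i-simplex of edge 1 in H_i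
   together with a circumcentre, placed at 0, of circumradius r < 1.  Put
   U = H_i, e = e_(i+1), and let G y be the least mu such that the mu-ball contains
   y + r (B `&` U).  If y minimizes G on its coset y + U, then, because the section
   of the (G y)-ball by y + U is a homothet of B `&` U, every u in U of norm r
   satisfies N (y + u) = G y; applied to -u, this says that y lies at distance G y
   from every vertex of the simplex.
   With h the e-coordinate, a highest point x of {G <= 1}, recentred in its section,
   is such a minimizer with G x = 1; it is the new vertex.  The coset minimizers of height between -h x and h x form a compact set
   whose fibres over the height are convex, so N (y - x) - G y, which is negative at
   x, vanishes somewhere on it as soon as it is positive at -x, i.e. N (2 x) > 1.
   This is the 2-intersection property if the section through x has radius r; if
   the radius is larger, then N x = 1 and N (2 x) = 2.  The zero, where moreover
   G y < 1, is the new circumcentre. *)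

Set Implicit Arguments.
Unset Strict Implicit.
Unset Printing Implicit Defensive.

Import Order.TTheory GRing.Theory Num.Theory.
Import numFieldNormedType.Exports.

Local Open Scope classical_set_scope.
Local Open Scope ring_scope.

(** * Intermediate values on compact sets and on segments *)

(** If [F] had no zero on [K], the parts [F <= 0] and [F >= 0] of [K] would have closed images under
    [h], disjoint by the fibre condition and covering [[a, b]], against connectedness of the
    interval. The fibre condition stands in for connectedness of [K]. *)
Lemma compact_fiber_IVT (R : realType) (T : topologicalType) (K : set T)
    (h F : T -> R) (a b : R) :
  compact K -> continuous h -> continuous F -> h @` K = `[a, b]%classic ->
  (forall x y, K x -> K y -> h x = h y -> F x < 0 -> 0 < F y ->
     exists2 z, K z & F z = 0) ->
  (exists2 x, K x & F x <= 0) -> (exists2 x, K x & 0 <= F x) ->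
  exists2 z, K z & F z = 0.
Proof.
move=> cK ch cF hK fib [x Kx Fx] [y Ky Fy].
apply: contrapT => nz.
have Fn0 z : K z -> F z != 0 by move=> Kz; apply/eqP => Fz; apply: nz; exists z.
pose Km := K `&` F @^-1` [set t | t <= 0].
pose Kp := K `&` F @^-1` [set t | 0 <= t].
have closed_img (D : set R) : closed D -> closed (h @` (K `&` F @^-1` D)).
  move=> cD; apply: compact_closed; first exact: norm_hausdorff.
  apply: continuous_compact; first exact: continuous_subspaceT.
  apply: compact_closedI => //.
  by apply: preimage_closed => // ? _; exact: cF.
have disj t : (h @` Km) t -> (h @` Kp) t -> False.
  move=> [u [Ku Fu] hu] [v [Kv Fv] hv]; apply: nz.
  apply: (fib u v) => //; first by rewrite hu hv.
    by rewrite lt_neqAle Fn0.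
  by rewrite lt_neqAle eq_sym Fn0.
have cover t : `[a, b]%classic t -> (h @` Km) t \/ (h @` Kp) t.
  rewrite -hK => -[u Ku <-]; case: (leP (F u) 0) => Fu.
    by left; exists u.
  by right; exists u => //; split => //; exact: ltW.
have sub (D : set R) : h @` (K `&` F @^-1` D) `<=` `[a, b]%classic.
  by rewrite -hK => _ [u [Ku _] <-]; exists u.
have Eab : h @` Km = `[a, b]%classic.
  apply: segment_connected.
  - by exists (h x); exists x.
  - exists (~` (h @` Kp)).
      by rewrite openC; apply: closed_img; exact: closed_ge.
  rewrite eqEsubset; split => t.
      by move=> mt; split; [exact: sub mt|move=> /disj; apply].
    by move=> [/cover[//|//]].
  - exists (h @` Km); first by apply: closed_img; exact: closed_le.
    by rewrite setIC; apply/esym/setIidl; exact: sub.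
have hy : (h @` Kp) (h y) by exists y.
by apply: (disj (h y)) => //; rewrite Eab; exact: sub hy.
Qed.


Lemma segment_IVT (R : realType) (n : nat) (F : 'rV[R]_n -> R) (y z : 'rV[R]_n) :
  continuous F -> F y < 0 -> 0 < F z ->
  exists2 t, 0 <= t <= 1 & F (t *: z + (1 - t) *: y) = 0.
Proof.
move=> cF Fy Fz.
pose f (t : R) := F (t *: z + (1 - t) *: y).
have cf : continuous f.
  move=> t; apply: continuous_comp; last exact: cF.
  apply: cvgD; first by apply: cvgZr_tmp; exact: cvg_id.
  by apply: cvgZr_tmp; apply: cvgB; [exact: cvg_cst|exact: cvg_id].
have [|t] := @IVT _ f 0 1 0 ler01 (continuous_subspaceT cf).
  rewrite /f !scale0r !add0r !subr0 subrr scale0r addr0 !scale1r.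
  by rewrite ge_min le_max (ltW Fy) (ltW Fz) orbT.
by rewrite in_itv/= => t01 ft; exists t.
Qed.

(** * Continuity of functions dominated by a seminorm *)

Section Seminorm.
Variables (R : realType) (n : nat) (q : 'rV[R]_n -> R).
Hypothesis q_tri : forall x y, q (x + y) <= q x + q y.
Hypothesis q_scale : forall (a : R) x, q (a *: x) = `|a| * q x.
Local Notation V := 'rV[R]_n.

Lemma seminorm_bound : exists2 C : R, 0 < C & forall x, q x <= C * `|x|.
Proof.
have q0 : q 0 = 0 by rewrite -(scale0r (0 : V)) q_scale normr0 mul0r.
have q_ge0 x : 0 <= q x.
  by have := q_tri x (- x); rewrite subrr q0 -scaleN1r q_scale normrN1; lra.
exists (1 + \sum_j q (delta_mx 0 j)) => [|x].
  by rewrite ltr_pwDl// sumr_ge0.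
rewrite mulrDl mul1r {1}(row_sum_delta x).
have /le_trans : q (\sum_j x 0 j *: delta_mx 0 j) <= \sum_j `|x| * q (delta_mx 0 j).
  elim/big_ind2: _ => [|u a v b ua vb|j _]; first by rewrite q0.
    by apply: le_trans (q_tri _ _) _; exact: lerD.
  rewrite q_scale ler_wpM2r//.
  by rewrite /Num.norm/= mx_normrE (le_trans _ (le_bigmax _ _ (0, j))).
apply; rewrite -mulr_sumr mulrC lerDr; exact: normr_ge0.
Qed.

(** Exchanging [x] and [y] makes the one-sided bound a Lipschitz bound. The seminorm may be
    degenerate, as it is for [dot] and for the distance to a subspace. *)
Lemma seminorm_dominated_continuous (f : V -> R) :
  (forall x y, f y <= f x + q (y - x)) -> continuous f.
Proof.
move=> fq x; have [C C0 qC] := seminorm_bound.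
apply/(@cvgrPdist_le _ _ _ (nbhs (x : V)) _ f (f x)) => e e0.
near=> y.
have : `|x - y| <= e / C.
  by near: y; apply: cvgr_dist_le; [exact: cvg_id|exact: divr_gt0].
rewrite ler_pdivlMr// mulrC => xy.
have := fq x y; have := fq y x; have := qC (x - y); have := qC (y - x).
rewrite [`|y - x|]distrC ler_norml => *.
by apply/andP; split; lra.
Unshelve. all: by end_near.
Qed.

End Seminorm.

(** * Norm calculus, and compactness of closed bounded sets *)

Section Norm.
Variables (R : realType) (n : nat) (N : 'rV[R]_n -> R).
Hypothesis normN : is_norm N.
Local Notation V := 'rV[R]_n.
Implicit Types x y z u v : V.

Lemma norm_tri x y : N (x + y) <= N x + N y.
Proof. by case: normN. Qed.

Lemma norm_scale a x : N (a *: x) = `|a| * N x.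
Proof. by case: normN. Qed.

Lemma norm_eq0 x : N x = 0 -> x = 0.
Proof. by case: normN => _ _; exact. Qed.

Lemma norm0 : N 0 = 0.
Proof. by rewrite -(scale0r (0 : V)) norm_scale normr0 mul0r. Qed.

Lemma normN_opp x : N (- x) = N x.
Proof. by rewrite -scaleN1r norm_scale normrN1 mul1r. Qed.

Lemma norm_sub_sym x y : N (x - y) = N (y - x).
Proof. by rewrite -opprB normN_opp. Qed.

Lemma norm_tri_sub x y : N (x - y) <= N x + N y.
Proof. by rewrite -[N y]normN_opp norm_tri. Qed.

Lemma norm_ge0 x : 0 <= N x.
Proof. by have := norm_tri x (- x); rewrite normN_opp subrr norm0; lra. Qed.

Lemma norm_gt0 x : x != 0 -> 0 < N x.
Proof.
move=> x0; rewrite lt_neqAle norm_ge0 andbT; apply: contra_neq x0 => /esym.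
exact: norm_eq0.
Qed.

Lemma norm_scale_ge0 a x : 0 <= a -> N (a *: x) = a * N x.
Proof. by move=> a0; rewrite norm_scale ger0_norm. Qed.

Lemma norm_mid x y t : 0 <= t <= 1 ->
  N (t *: x + (1 - t) *: y) <= t * N x + (1 - t) * N y.
Proof.
move=> /andP[t0 t1]; apply: (le_trans (norm_tri _ _)).
by rewrite !norm_scale_ge0 ?subr_ge0.
Qed.

Lemma norm_sum (I : Type) (s : seq I) (P : pred I) (f : I -> V) :
  N (\sum_(i <- s | P i) f i) <= \sum_(i <- s | P i) N (f i).
Proof.
elim/big_ind2: _ => [|x a y b xa yb|//]; first by rewrite norm0.
by apply: le_trans (norm_tri _ _) _; exact: lerD.
Qed.

Lemma lipschitz_continuous (f : V -> R) :
  (forall x y, f y <= f x + N (y - x)) -> continuous f.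
Proof.
exact: seminorm_dominated_continuous norm_tri norm_scale f.
Qed.

Lemma continuous_normX : continuous N.
Proof.
apply: lipschitz_continuous => x y.
by rewrite -[in N y](subrKC x y) norm_tri.
Qed.

(** A subspace is the zero set of the continuous seminorm [N (x - projv U x)]. *)
Lemma closed_vspace (U : {vspace V}) : closed [set x | x \in U].
Proof.
pose q x := N (x - projv U x).
have q_tri x y : q (x + y) <= q x + q y.
  by rewrite /q linearD opprD addrACA norm_tri.
have q_scale (a : R) x : q (a *: x) = `|a| * q x.
  by rewrite /q linearZ -scalerBr norm_scale.
have cq : continuous q.
  apply: (seminorm_dominated_continuous q_tri q_scale) => x y.
  by rewrite -[in q y](subrKC x y) q_tri.
have -> : [set x | x \in U] = q @^-1` [set t | t = 0].
  rewrite eqEsubset; split => x /=.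
    by rewrite /q => xU; rewrite projv_id// subrr norm0.
  by move=> /norm_eq0/eqP; rewrite subr_eq0 => /eqP->; exact: memv_proj.
by apply: preimage_closed; [move=> x _; exact: cq|exact: closed_eq].
Qed.

(** The constant is the minimum of [N] on the unit sphere of the max norm. *)
Lemma norm_dominates : exists2 m : R, 0 < m & forall x : V, m * `|x| <= N x.
Proof.
pose S : set V := [set x | `|x| = 1].
have scS (x : V) : x != 0 -> S (`|x|^-1 *: x).
  move=> x0; rewrite /S/= normrZ normfV normr_id mulVf//.
  by rewrite normr_eq0.
(* An empty sphere forces every vector to be 0, and any positive constant will do. *)
have [S0|/nonemptyPn S0] := pselect (S !=set0); last first.
  exists 1 => // x; have [->|/scS] := eqVneq x 0; last by rewrite S0.
  by rewrite normr0 mulr0 norm0.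
have cS : compact S.
  apply: bounded_closed_compact.
    exists 1; split => // M M1 x /= ->; exact: ltW.
  have -> : S = (fun x : V => `|x|) @^-1` [set t | t = 1] by [].
  apply: preimage_closed; last exact: closed_eq.
  by move=> x _; exact: norm_continuous.
have [c /= Sc cmin] := EVT_min_rV S0 cS (continuous_subspaceT continuous_normX).
have c0 : c != 0.
  apply/eqP => c0; move: Sc; rewrite inE /S/= c0 normr0 => /eqP.
  by rewrite eq_sym oner_eq0.
exists (N c) => [|x]; first exact: norm_gt0.
have [->|x0] := eqVneq x 0; first by rewrite normr0 mulr0 norm0.
have := cmin (`|x|^-1 *: x); rewrite inE => /(_ (scS _ x0)).
rewrite norm_scale normfV normr_id mulrC ler_pdivlMr ?normr_gt0//.
Qed.

Lemma norm_bounded_compact (A : set V) (c : R) :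
  closed A -> (forall x, A x -> N x <= c) -> compact A.
Proof.
move=> cA Ac; have [m m0 mN] := norm_dominates.
apply: bounded_closed_compact => //.
exists (c / m); split => [|M cM x Ax]; first exact: num_real.
apply: le_trans (ltW cM); rewrite ler_pdivlMr// mulrC.
by apply: le_trans (mN x) _; exact: Ac.
Qed.

End Norm.

(** * Linearity and continuity of the height [dot x e] *)

Section Dot.
Variables (R : realType) (n : nat).
Implicit Types x y e : 'rV[R]_n.

Lemma dotDl x y e : dot (x + y) e = dot x e + dot y e.
Proof. by rewrite -big_split; apply: eq_bigr => k _; rewrite mxE mulrDl. Qed.

Lemma dotZl a x e : dot (a *: x) e = a * dot x e.
Proof. by rewrite /dot mulr_sumr; apply: eq_bigr => k _; rewrite mxE mulrA. Qed.

Lemma dotNl x e : dot (- x) e = - dot x e.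
Proof. by rewrite -scaleN1r dotZl mulN1r. Qed.

Lemma dotBl x y e : dot (x - y) e = dot x e - dot y e.
Proof. by rewrite dotDl dotNl. Qed.

Lemma continuous_dotl e : continuous (fun x : 'rV[R]_n => dot x e).
Proof.
apply: (@seminorm_dominated_continuous _ _ (fun x => `|dot x e|)) => [x y|a x|x y].
- by rewrite dotDl ler_normD.
- by rewrite dotZl normrM.
- by rewrite -lerBlDl -dotBl ler_norm.
Qed.

End Dot.

(** * Covering radii on the cosets of [U] *)

Section Cover.
Variables (R : realType) (n : nat) (N : 'rV[R]_n -> R) (U : {vspace 'rV[R]_n}).
Hypothesis normN : is_norm N.
Local Notation V := 'rV[R]_n.
Implicit Types x y z u v d : V.

(* The least mu such that the mu-ball contains y + r (B `&` U). *)
Definition cover_radius (r : R) y : R :=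
  sup [set N (y + u) | u in [set u | u \in U /\ N u <= r]].

(** Membership form of a homothety: the section of the [mu]-ball by [z + U] is the [rho]-ball of [U]
    moved to [z]. *)
Definition ball_section (mu rho : R) z :=
  forall u, u \in U -> (N (z + u) <= mu) <-> (N u <= rho).

Definition coset_min (r : R) y :=
  forall u, u \in U -> cover_radius r y <= cover_radius r (y + u).

Variable r : R.
Hypothesis r_gt0 : 0 < r.

Lemma le_cover y u : u \in U -> N u <= r -> N (y + u) <= cover_radius r y.
Proof.
move=> uU ur; apply: ub_le_sup; last by exists u.
exists (N y + r) => _ [v [_ vr] <-].
by apply: le_trans (norm_tri normN _ _) _; rewrite lerD2l.
Qed.

Lemma cover_le y c : (forall u, u \in U -> N u <= r -> N (y + u) <= c) ->
  cover_radius r y <= c.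
Proof.
move=> yc; apply: ge_sup.
  by exists (N (y + 0)), 0 => //; split; [exact: mem0v|rewrite norm0// ltW].
by move=> _ [u [uU ur] <-]; exact: yc.
Qed.

Lemma cover_lipschitz x y : cover_radius r y <= cover_radius r x + N (y - x).
Proof.
apply: cover_le => u uU ur; rewrite -(subrK x y) -addrA addrC.
by apply: le_trans (norm_tri normN _ _) _; rewrite subrK lerD2r le_cover.
Qed.

Lemma continuous_cover : continuous (cover_radius r).
Proof. apply: (lipschitz_continuous normN); exact: cover_lipschitz. Qed.

Lemma cover_convex x y t : 0 <= t <= 1 ->
  cover_radius r (t *: x + (1 - t) *: y) <=
    t * cover_radius r x + (1 - t) * cover_radius r y.
Proof.
move=> t01; have /andP[t0 t1] := t01; apply: cover_le => u uU ur.
have -> : t *: x + (1 - t) *: y + u = t *: (x + u) + (1 - t) *: (y + u).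
  by rewrite !scalerDr addrACA -scalerDl [t + _]addrC subrK scale1r.
apply: le_trans (norm_mid normN _ _ t01) _.
by rewrite lerD// ler_wpM2l ?subr_ge0// le_cover.
Qed.

Lemma cover_opp y : cover_radius r (- y) = cover_radius r y.
Proof.
have le_opp x : cover_radius r (- x) <= cover_radius r x.
  apply: cover_le => u uU ur; rewrite -(normN_opp normN) opprD opprK.
  by rewrite le_cover ?memvN// normN_opp.
by apply/le_anti; rewrite le_opp -{1}[y]opprK le_opp.
Qed.

Lemma norm_le_cover y : N y <= cover_radius r y.
Proof. by rewrite -[in N y](addr0 y) le_cover ?mem0v// norm0// ltW. Qed.

Lemma cover0 : cover_radius r 0 <= r.
Proof. by apply: cover_le => u _; rewrite add0r. Qed.

Variable u0 : V.
Hypotheses (u0U : u0 \in U) (u0r : N u0 = r).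

(** The points [y + u0] and [y - u0] have norm at most the covering radius and lie [2 * r] apart. *)
Lemma cover_ge y : r <= cover_radius r y.
Proof.
have yp : N (y + u0) <= cover_radius r y by rewrite le_cover// u0r.
have ym : N (y - u0) <= cover_radius r y by rewrite le_cover ?memvN ?normN_opp ?u0r.
have := norm_tri_sub normN (y + u0) (y - u0).
have -> : y + u0 - (y - u0) = 2 *: u0 by rewrite opprB addrC addrA subrK scaler_nat.
by rewrite norm_scale_ge0// u0r; lra.
Qed.

(** The vector of norm [r] in the direction of [d] realises [N d + r]; for [d = 0], [u0] takes its
    place. *)
Lemma ball_in_ball rho d : d \in U ->
  (forall u, u \in U -> N u <= r -> N (d + u) <= rho) -> N d + r <= rho.
Proof.
move=> dU; case: (eqVneq d 0) => [->|d0] sub.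
  by have := sub u0 u0U; rewrite norm0// !add0r u0r; apply.
have Nd := norm_gt0 normN d0.
have c0 : 0 <= r / N d by rewrite divr_ge0 ?ltW.
have := sub _ (memvZ (r / N d) dU).
rewrite -[X in X + _ *: d]scale1r -scalerDl norm_scale_ge0// norm_scale_ge0 ?addr_ge0//.
by rewrite mulrDl mul1r divfK ?gt_eqF//; apply.
Qed.

Lemma cover_in_section mu rho z y : ball_section mu rho z -> y - z \in U ->
  cover_radius r y <= mu -> N (y - z) + r <= rho.
Proof.
move=> zrho yzU ymu; apply: ball_in_ball => // u uU ur.
apply/(zrho _); first exact: memvD.
by rewrite addrA [z + _]addrC subrK; apply: le_trans ymu; exact: le_cover.
Qed.

(* Moving the centre of a section towards a point q at which N is below mu
   leaves room for a ball of radius r < rho. *)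
Lemma cover_lt_of_deep mu rho z q : ball_section mu rho z -> r < rho ->
  q - z \in U -> N q < mu -> exists2 y, y - z \in U & cover_radius r y < mu.
Proof.
move=> zrho rrho qzU qmu.
have rho0 : 0 < rho by exact: lt_trans rrho.
(* With this ratio [N u <= r] gives [N (t^-1 *: u) <= rho], so [z + t^-1 *: u] stays in the
   [mu]-ball; the share [1 - t] of [q] makes the bound strict. *)
pose t := r / rho.
have t0 : 0 < t by rewrite divr_gt0.
have t1 : t < 1 by rewrite ltr_pdivrMr// mul1r.
exists (t *: z + (1 - t) *: q).
  have -> : t *: z + (1 - t) *: q - z = (1 - t) *: (q - z).
    by apply/rowP => j; rewrite !mxE; ring.
  exact: memvZ.
apply: (@le_lt_trans _ _ (t * mu + (1 - t) * N q)); last by nra.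
apply: cover_le => u uU ur.
have -> : t *: z + (1 - t) *: q + u = t *: (z + t^-1 *: u) + (1 - t) *: q.
  by rewrite scalerDr scalerA divff ?gt_eqF// scale1r addrAC.
apply: le_trans (norm_mid normN _ _ _) _; first by rewrite !ltW.
rewrite lerD2r ler_pM2l//; apply/(zrho _); first exact: memvZ.
by rewrite norm_scale_ge0 ?invr_ge0 ?(ltW t0)// ler_pdivrMl// divfK ?gt_eqF.
Qed.

Hypothesis section_ball1 : forall x, N x <= 1 ->
  exists z rho, [/\ z - x \in U, 0 <= rho & ball_section 1 rho z].

Lemma section_ball mu x : 0 < mu -> N x <= mu ->
  exists z rho, [/\ z - x \in U, 0 <= rho & ball_section mu rho z].
Proof.
move=> mu0 xmu; have mu'0 : 0 <= mu^-1 by rewrite invr_ge0 ltW.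
have [|z [rho [zx rho0 zrho]]] := @section_ball1 (mu^-1 *: x).
  by rewrite norm_scale_ge0// mulrC ler_pdivrMr// mul1r.
exists (mu *: z), (mu * rho); split => [||u uU].
- have -> : mu *: z - x = mu *: (z - mu^-1 *: x).
    by rewrite scalerBr scalerA divff ?gt_eqF// scale1r.
  exact: memvZ.
- by rewrite mulr_ge0// ltW.
have -> : mu *: z + u = mu *: (z + mu^-1 *: u).
  by rewrite scalerDr scalerA divff ?gt_eqF// scale1r.
rewrite norm_scale_ge0 ?(ltW mu0)// -ler_pdivlMl// mulVf ?gt_eqF//.
apply: (iff_trans (zrho _ (memvZ _ uU))).
by rewrite norm_scale_ge0// mulrC ler_pdivrMr// mulrC.
Qed.

(** Suppose [N (y + u) < mu]. If [r < rho], moving the centre of the section towards [y + u] lowers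
    the covering radius, against minimality. Otherwise [y] is the centre, and the slack in the
    direction of [u] extends the section beyond [rho]. *)
Lemma norm_coset_min y u : coset_min r y -> u \in U -> N u = r ->
  N (y + u) = cover_radius r y.
Proof.
move=> ymin uU ur; set mu := cover_radius r y.
have mu0 : 0 < mu := lt_le_trans r_gt0 (cover_ge y).
have [z [rho [zy rho0 zrho]]] := section_ball mu0 (norm_le_cover y).
have yz : y - z \in U by rewrite -opprB memvN.
have yrho := cover_in_section zrho yz (lexx mu).
apply/eqP; rewrite eq_le le_cover ?ur//=; rewrite leNgt; apply/negP => yu.
have [rrho|rhor] := ltP r rho.
  have [|x xz xmu] := cover_lt_of_deep zrho rrho (q := y + u) _ yu.
    by rewrite addrAC memvD.
  have xyU : x - y \in U by rewrite -(subrK z x) -addrA memvD.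
  by have := ymin _ xyU; rewrite [y + _]addrC subrK leNgt xmu.
(* [N (y - z) + r <= rho <= r] leaves no distance between [y] and the centre. *)
have yz0 : y = z.
  apply/eqP; rewrite -subr_eq0; apply/eqP/(norm_eq0 normN)/le_anti.
  by rewrite norm_ge0// andbT; lra.
(* [eps *: u] has norm exactly the slack, so [y + (1 + eps) *: u] is still in the [mu]-ball. *)
subst z; pose eps := (mu - N (y + u)) / r.
have eps0 : 0 < eps by rewrite divr_gt0// subr_gt0.
have : N ((1 + eps) *: u) <= rho.
  apply/(zrho _ (memvZ _ uU)).
  rewrite scalerDl scale1r addrA; apply: le_trans (norm_tri normN _ _) _.
  by rewrite norm_scale_ge0 ?(ltW eps0)// ur /eps divfK ?gt_eqF// subrKC.
rewrite norm_scale_ge0 ?addr_ge0 ?(ltW eps0)// ur mulrDl mul1r => le_rho.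
by have := mulr_gt0 eps0 r_gt0; lra.
Qed.

End Cover.

(** * The apex over [U] and the new circumcentre *)

Section Apex.
Variables (R : realType) (n : nat) (N : 'rV[R]_n -> R) (U : {vspace 'rV[R]_n}).
Variables (e : 'rV[R]_n) (r : R) (u0 : 'rV[R]_n).
Hypothesis normN : is_norm N.
Hypotheses (dot_ee : dot e e = 1) (dot_Ue : forall u, u \in U -> dot u e = 0).
Hypotheses (r_gt0 : 0 < r) (r_lt1 : r < 1) (u0U : u0 \in U) (u0r : N u0 = r).
Hypothesis section_ball1 : forall x, N x <= 1 ->
  exists z rho, [/\ z - x \in U, 0 <= rho & ball_section N U 1 rho z].
Local Notation V := 'rV[R]_n.
Local Notation W := (U + <[e]>)%VS.
Local Notation G := (cover_radius N U r).
Local Notation h := (fun y : V => dot y e).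
Implicit Types x y z u v : V.

Lemma subU y : y \in U -> y \in W.
Proof. exact/subvP/addvSl. Qed.

Lemma memWe a : a *: e \in W.
Proof. by rewrite (subvP (addvSr U <[e]>))// memvZ// memv_line. Qed.

Lemma mem_same_height x y : x \in W -> y \in W -> h x = h y -> x - y \in U.
Proof.
move=> /memv_addP[u uU [_ /vlineP[a ->] ->]] /memv_addP[v vU [_ /vlineP[b ->] ->]].
rewrite !dotDl !dotZl dot_ee !dot_Ue// !add0r !mulr1 => ->.
by rewrite opprD addrACA subrr addr0 memvB.
Qed.

Lemma norm_e_gt0 : 0 < N e.
Proof.
apply: norm_gt0 => //; apply/eqP => e0; move: dot_ee.
by rewrite e0 -(scale0r (0 : V)) dotZl mul0r => /esym/eqP; rewrite oner_eq0.
Qed.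

Lemma norm_scale_div c : 0 <= c -> N ((c / N e) *: e) = c.
Proof.
have Ne := norm_e_gt0 => c0.
by rewrite norm_scale_ge0 ?divr_ge0 ?(ltW Ne)// divfK ?gt_eqF.
Qed.

Lemma compact_cover_le : compact [set y | y \in W /\ G y <= 1].
Proof.
apply: (@norm_bounded_compact _ _ _ normN _ 1).
  apply: (closedI (closed_vspace normN (U := W))).
  apply: (@preimage_closed _ _ G [set t | t <= 1]); last exact: closed_le.
  by move=> ? _; exact: continuous_cover.
by move=> y [_]; apply: le_trans; exact: (norm_le_cover U normN r_gt0).
Qed.

(** A highest point [x1] of [G <= 1] is replaced by the centre [z] of its section, at the same
    height. The section contains the [r]-ball about [x1], so [r <= rho] and [G z <= 1]. *)
Lemma exists_apex : exists x, [/\ x \in W, 0 < h x, G x <= 1,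
  forall y, y \in W -> G y <= 1 -> h y <= h x
  & exists rho, ball_section N U 1 rho x].
Proof.
have G01 : G 0 <= r by exact: cover0.
have [||x1] := @compact_EVT_max _ _ h _ _ compact_cover_le.
- by exists 0; split; [exact: mem0v|exact: le_trans (ltW r_lt1)].
- by apply: continuous_subspaceT; exact: continuous_dotl.
rewrite inE => -[x1W Gx1] x1max.
have [z [rho [zx1 rho0 zrho]]] :=
  section_ball1 (le_trans (norm_le_cover U normN r_gt0 x1) Gx1).
have x1z : x1 - z \in U by rewrite -opprB memvN.
have hz : h z = h x1 by apply/eqP; rewrite -subr_eq0 -dotBl dot_Ue.
have := cover_in_section normN r_gt0 u0U u0r zrho x1z Gx1.
have := norm_ge0 normN (x1 - z) => Nx1z rrho.
exists z; split; last by exists rho.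
- by rewrite -(subrK x1 z) memvD// subU.
(* Lifting 0 by [a *: e] raises [G] from at most [r] to at most 1. *)
- rewrite hz; pose a := (1 - r) / N e.
  have a0 : 0 < a by rewrite divr_gt0 ?norm_e_gt0// subr_gt0.
  have := x1max (a *: e); rewrite inE dotZl dot_ee mulr1 => xa.
  apply: lt_le_trans a0 (xa _); split; first exact: memWe.
  apply: le_trans (cover_lipschitz U normN r_gt0 0 _) _; rewrite subr0.
  by rewrite norm_scale_div ?subr_ge0 ?(ltW r_lt1)//; lra.
- by apply: cover_le => // u uU ur; apply/(zrho _ uU); lra.
- by move=> y yW yG; rewrite hz x1max// inE.
Qed.

Variables (x : V) (rho : R).
Hypotheses (xW : x \in W) (hx_gt0 : 0 < h x) (Gx_le1 : G x <= 1).
Hypothesis x_max : forall y, y \in W -> G y <= 1 -> h y <= h x.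
Hypothesis x_section : ball_section N U 1 rho x.

(** If [G y < 1], a small lift along [e] keeps [G <= 1] and rises above the maximal height. *)
Lemma cover_ge1 y : y \in W -> h y = h x -> 1 <= G y.
Proof.
move=> yW hy; rewrite leNgt; apply/negP => Gy.
pose a := (1 - G y) / N e.
have a0 : 0 < a by rewrite divr_gt0 ?norm_e_gt0// subr_gt0.
suff : h (y + a *: e) <= h x by rewrite dotDl dotZl dot_ee hy; lra.
apply: x_max; first by rewrite memvD// memWe.
apply: le_trans (cover_lipschitz U normN r_gt0 y _) _.
by rewrite [y + _]addrC addrK norm_scale_div ?subr_ge0 ?(ltW Gy)//; lra.
Qed.

Lemma cover_apex : G x = 1.
Proof. by apply/le_anti; rewrite Gx_le1 cover_ge1. Qed.

Lemma coset_min_apex : coset_min N U r x.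
Proof.
move=> u uU; rewrite cover_apex cover_ge1//; first by rewrite memvD// subU.
by rewrite dotDl (dot_Ue uU) addr0.
Qed.

(** Convexity of [G] between 0, where it is at most [r], and [x], where it is 1; evenness of [G]
    settles the sign of [a]. *)
Lemma cover_scale_apex a : `|a| <= 1 -> G (a *: x) <= r + `|a| * (1 - r).
Proof.
move=> a1.
have -> : G (a *: x) = G (`|a| *: x).
  by case: (ger0P a) => // _; rewrite scaleNr cover_opp.
rewrite -[_ *: x]addr0 -(scaler0 _ (1 - `|a|)).
apply: le_trans (cover_convex U normN r_gt0 _ _ _) _; first by rewrite normr_ge0.
have := cover0 U normN r_gt0; rewrite cover_apex mulr1.
by have := normr_ge0 a; nra.
Qed.

Lemma r_le_rho : r <= rho.
Proof.
have := cover_in_section normN r_gt0 u0U u0r x_section _ Gx_le1.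
by rewrite subrr mem0v norm0// add0r; apply.
Qed.

(** For [u] in [U] of norm [rho], both [x + u] and [x - u] lie in the unit ball and are [2 * rho]
    apart. *)
Lemma rho_le1 : rho <= 1.
Proof.
have rrho := r_le_rho; have rho0 : 0 < rho by exact: lt_le_trans rrho.
have c0 : 0 <= rho / r by rewrite divr_ge0 ?ltW.
pose u := (rho / r) *: u0.
have uU : u \in U by rewrite memvZ.
have uNU : - u \in U by rewrite memvN.
have Nu : N u = rho by rewrite norm_scale_ge0// u0r divfK ?gt_eqF.
have xp : N (x + u) <= 1 by apply/(x_section uU); rewrite Nu.
have xm : N (x - u) <= 1 by apply/(x_section uNU); rewrite normN_opp// Nu.
have := norm_tri_sub normN (x + u) (x - u).
have -> : x + u - (x - u) = 2 *: u by apply/rowP => j; rewrite !mxE; ring.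
by rewrite norm_scale_ge0// Nu; lra.
Qed.

Lemma coset_min_le y z : coset_min N U r y -> z - y \in U -> G z <= G y ->
  coset_min N U r z.
Proof.
move=> ymin zyU zy u uU; apply: le_trans zy _.
have := ymin _ (memvD zyU uU); congr (_ <= G _).
by rewrite addrA subrKC.
Qed.

Let K := [set y | [/\ y \in W, coset_min N U r y & h y \in `[- h x, h x]]].

(** The minimizer [y] is compared with the point of the segment from [- x] to [x] at the same
    height, which lies in the same coset. *)
Lemma coset_min_apex_le y : K y -> G y <= r + `|h y / h x| * (1 - r).
Proof.
move=> [yW ymin hy].
have xy : (h y / h x) *: x - y \in U.
  by apply: mem_same_height => //; [rewrite memvZ|rewrite dotZl divfK ?gt_eqF].
have := ymin _ xy; rewrite subrKC => /le_trans; apply.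
apply: cover_scale_apex; rewrite normrM normfV (gtr0_norm hx_gt0).
by rewrite ler_pdivrMr// mul1r ler_norml; move: hy; rewrite in_itv.
Qed.

Lemma cover_le1 y : K y -> G y <= 1.
Proof.
move=> Ky; apply: le_trans (coset_min_apex_le Ky) _.
case: Ky => _ _; rewrite in_itv/= -ler_norml => hy.
have : `|h y / h x| <= 1.
  by rewrite normrM normfV (gtr0_norm hx_gt0) ler_pdivrMr// mul1r.
by have := r_lt1; nra.
Qed.

Lemma compact_coset_min : compact K.
Proof.
apply: (@norm_bounded_compact _ _ _ normN _ 1); last first.
  by move=> y /cover_le1; apply: le_trans; exact: (norm_le_cover U normN r_gt0).
(* Minimality becomes an intersection, over [u] in [U], of closed conditions. *)
have -> : K = [set y | y \in W] `&`
    \bigcap_(u in [set u | u \in U]) [set y | G y - G (y + u) <= 0] `&`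
    h @^-1` `[- h x, h x].
  rewrite eqEsubset; split => y /=.
    by move=> [yW ymin hy]; split => //; split => // u uU /=; rewrite subr_le0 ymin.
  by move=> [[yW ymin] hy]; split => // u uU; rewrite -subr_le0; exact: ymin.
apply: closedI; first apply: (closedI (closed_vspace normN (U := W))).
  apply: closed_bigI => u _.
  apply: (@preimage_closed _ _ (fun y => G y - G (y + u)) [set t | t <= 0]);
    last exact: closed_le.
  move=> y _; apply: (@continuousB _ _ _ G); first exact: continuous_cover.
  apply: (lipschitz_continuous normN) => v w.
  have -> : w - v = w + u - (v + u) by rewrite opprD addrACA subrr addr0.
  exact: cover_lipschitz.
apply: preimage_closed; last exact: itv_closed.
by move=> y _; exact: continuous_dotl.
Qed.

(** At each height [G] is minimized over the compact set [G <= 1], which meets the coset in a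
    multiple of [x]; points with [G > 1] cannot do better. *)
Lemma coset_min_heights : h @` K = `[- h x, h x]%classic.
Proof.
rewrite eqEsubset; split => [_ [y [_ _ hy] <-]//|s /= sx].
pose B := [set y | y \in W /\ G y <= 1] `&` [set y | h y = s].
have cB : compact B.
  apply: compact_closedI; first exact: compact_cover_le.
  apply: (@preimage_closed _ _ h [set t | t = s]); last exact: closed_eq.
  by move=> y _; exact: continuous_dotl.
have B0 : B ((s / h x) *: x).
  split; last by rewrite /= dotZl divfK ?gt_eqF.
  split; first by rewrite memvZ.
  have sx1 : `|s / h x| <= 1.
    rewrite normrM normfV (gtr0_norm hx_gt0) ler_pdivrMr// mul1r ler_norml.
    by move: sx; rewrite in_itv.
  by apply: le_trans (cover_scale_apex sx1) _; have := r_lt1; nra.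
have [||y] := @compact_EVT_min _ _ G B _ cB.
- by eexists; exact: B0.
- by apply: continuous_subspaceT; exact: continuous_cover.
rewrite inE => -[[yW Gy] hy] ymin; exists y => //; split => //; last by rewrite hy.
move=> u uU; have [yu|] := leP (G (y + u)) 1; last by move/ltW; exact: le_trans.
apply: ymin; rewrite inE; split; last by rewrite /= dotDl (dot_Ue uU) addr0.
by split => //; rewrite memvD// subU.
Qed.

(** The threshold serves to exclude [G z = 1] at the zero [z]. At height [h x] it would give
    [1 <= rho - r]; at height [- h x], [N (2 *: x) <= 1 + (rho - r)]; strictly between,
    [coset_min_apex_le] gives [G z < 1]. *)
Lemma exists_circumcenter : 1 + (rho - r) < N (2 *: x) ->
  exists y, [/\ y \in W, coset_min N U r y, G y < 1 & N (y - x) = G y].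
Proof.
move=> Nx; pose F y := N (y - x) - G y.
have cF : continuous F.
  move=> y; apply: (@continuousB _ _ _ (fun y => N (y - x)) G);
    last exact: continuous_cover.
  apply: (lipschitz_continuous normN) => v w.
  have -> : w - x = v - x + (w - v) by apply/rowP => j; rewrite !mxE; ring.
  exact: norm_tri.
have hh : - h x <= h x by have := hx_gt0; lra.
have Kx : K x by split => //; [exact: coset_min_apex|rewrite in_itv/= lexx hh].
have KNx : K (- x).
  split; first by rewrite memvN.
    move=> u; rewrite -memvN => /coset_min_apex.
    have -> : - x + u = - (x - u) by rewrite opprB addrC.
    by rewrite !cover_opp.
  by rewrite dotNl in_itv/= lexx hh.
have rrho := r_le_rho; have rho1 := rho_le1.
have near_apex y : y \in W -> h y = h x -> G y <= 1 -> N (y - x) <= rho - r.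
  move=> yW hy Gy; have yx := mem_same_height yW xW hy.
  by have := cover_in_section normN r_gt0 u0U u0r x_section yx Gy; lra.
have [z Kz Fz] : exists2 z, K z & F z = 0.
  apply: (compact_fiber_IVT compact_coset_min _ cF coset_min_heights).
  - exact: continuous_dotl.
  (* Minimizers of equal height share a coset, so by convexity of [G] the segment joining them
     consists of minimizers. *)
  - move=> y z Ky Kz hyz Fy Fz; have [t t01 Ft] := segment_IVT cF Fy Fz.
    exists (t *: z + (1 - t) *: y) => //.
    have [yW ymin hy] := Ky; have [zW zmin hz] := Kz.
    have zyU : z - y \in U by exact: mem_same_height.
    have wy : t *: z + (1 - t) *: y - y = t *: (z - y).
      by apply/rowP => j; rewrite !mxE; ring.
    have Gzy : G z <= G y.
      by have := zmin (y - z); rewrite subrKC; apply; rewrite -opprB memvN.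
    split; first by rewrite memvD// memvZ.
      apply: coset_min_le ymin _ _; first by rewrite wy memvZ.
      by apply: le_trans (cover_convex U normN r_gt0 _ _ t01) _; nra.
    by rewrite dotDl !dotZl -hyz -mulrDl [t + _]addrC subrK mul1r.
  - by exists x => //; rewrite /F subrr norm0// cover_apex; lra.
  - exists (- x) => //; rewrite /F cover_opp// cover_apex.
    have -> : - x - x = - (2 *: x) by apply/rowP => j; rewrite !mxE; ring.
    by rewrite normN_opp// subr_ge0; apply: ltW; apply: le_lt_trans Nx; lra.
have [zW zmin hz] := Kz.
have NG : N (z - x) = G z by apply/eqP; rewrite -subr_eq0; apply/eqP.
exists z; split => //; rewrite ltNge; apply/negP => Gz1.
have Gz : G z = 1 by apply/le_anti; rewrite Gz1 cover_le1.
have [hzx|hzx] := eqVneq (h z) (h x).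
  by have := near_apex _ zW hzx; rewrite NG Gz; have := r_gt0; lra.
have [hzNx|hzNx] := eqVneq (h z) (- h x).
  have := near_apex (- z) _ _; rewrite memvN dotNl hzNx opprK cover_opp// Gz.
  move=> /(_ zW erefl (lexx 1)).
  rewrite -opprD normN_opp// => Nzx.
  have := norm_tri_sub normN (z + x) (z - x).
  have -> : z + x - (z - x) = 2 *: x by apply/rowP => j; rewrite !mxE; ring.
  by rewrite NG Gz; lra.
have : `|h z / h x| < 1.
  rewrite normrM normfV (gtr0_norm hx_gt0) ltr_pdivrMr// mul1r ltr_norml.
  by move: hz; rewrite in_itv/= !le_eqVlt (negbTE hzx) [- h x == _]eq_sym (negbTE hzNx).
by have := coset_min_apex_le Kz; rewrite Gz; have := r_lt1; nra.
Qed.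

End Apex.

(** The last hypothesis covers only sections of radius exactly [r]. If [r < rho], then
    [N (2 *: x) >= 2], which exceeds [1 + (rho - r)] because [rho <= 1]. *)
Lemma exists_apex_circumcenter (R : realType) (n : nat) (N : 'rV[R]_n -> R)
    (U : {vspace 'rV[R]_n}) (e : 'rV[R]_n) (r : R) (u0 : 'rV[R]_n) :
  is_norm N -> dot e e = 1 -> (forall u, u \in U -> dot u e = 0) ->
  0 < r -> r < 1 -> u0 \in U -> N u0 = r ->
  (forall x, N x <= 1 ->
    exists z rho, [/\ z - x \in U, 0 <= rho & ball_section N U 1 rho z]) ->
  (forall x, x \in (U + <[e]>)%VS -> 0 < dot x e -> ball_section N U 1 r x ->
    1 < N (2 *: x)) ->
  exists x y mu, [/\ x \in (U + <[e]>)%VS, y \in (U + <[e]>)%VS, 0 < dot x e,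
    forall u, u \in U -> N u = r -> N (x - u) = 1 /\ N (u - y) = mu
    & [/\ N (x - y) = mu, 0 < mu & mu < 1]].
Proof.
move=> normN ee Ue r0 r1 u0U u0r sec two.
have [x [xW hx Gx xmax [rho xrho]]] := exists_apex normN ee Ue r0 r1 u0U u0r sec.
have xmin := coset_min_apex normN ee Ue r0 xW Gx xmax.
have rrho := r_le_rho normN r0 u0U u0r Gx xrho.
have rho1 := rho_le1 normN r0 u0U u0r Gx xrho.
have [|y [yW ymin Gy Nyx]] :=
    exists_circumcenter normN ee Ue r0 r1 u0U u0r xW hx Gx xmax xrho.
  have [rhor|rrho'] := eqVneq rho r.
    by rewrite rhor subrr addr0; apply: two => //; rewrite -rhor.
  have {rrho'}rltrho : r < rho by rewrite lt_neqAle eq_sym rrho'.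
  (* Were [N x < 1], the section centre [x] would itself be a deep point, and [G x] would not be
     minimal. *)
  have Nx1 : 1 <= N x.
    rewrite leNgt; apply/negP => Nx.
    have [|y yx] := cover_lt_of_deep normN r0 xrho rltrho _ Nx.
      by rewrite subrr mem0v.
    have := xmin _ yx; rewrite subrKC.
    by have := cover_apex normN ee r0 xW Gx xmax => ->; rewrite leNgt => /negP.
  by rewrite norm_scale_ge0//; lra.
have NuN u : u \in U -> N u = r -> (- u \in U) /\ N (- u) = r.
  by rewrite memvN normN_opp.
exists x, y, (cover_radius N U r y); split => //.
  move=> u uU Nu; have [uNU NuNr] := NuN u uU Nu; split.
    rewrite (norm_coset_min normN r0 u0U u0r sec xmin uNU NuNr).
    exact: (cover_apex normN ee r0 xW Gx xmax).
  by rewrite norm_sub_sym// (norm_coset_min normN r0 u0U u0r sec ymin uNU NuNr).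
split => //; first by rewrite norm_sub_sym.
exact: (lt_le_trans r0 (cover_ge normN u0U u0r y)).
Qed.

(** * Convex hulls, inscribed simplices and sections in terms of the norm *)

Lemma translateP (R : realType) (n : nat) (x y : 'rV[R]_n) (U : {vspace 'rV[R]_n}) :
  translate x U y <-> y - x \in U.
Proof.
split => [[u uU <-]|yxU]; first by rewrite addrC addKr.
by exists (y - x) => //; rewrite subrKC.
Qed.

Section Hull.
Variables (R : realType) (n : nat) (N : 'rV[R]_n -> R).
Hypothesis normN : is_norm N.
Local Notation V := 'rV[R]_n.
Variables (m : nat) (p : 'I_m -> V).

Lemma convex_hull_sub (l : 'I_m -> R) (c : V) : \sum_(k < m) l k = 1 ->
  \sum_(k < m) l k *: p k - c = \sum_(k < m) l k *: (p k - c).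
Proof.
move=> l1; under [RHS]eq_bigr do rewrite scalerBr.
by rewrite sumrB -scaler_suml l1 scale1r.
Qed.

Lemma convex_hull_norm_le z c M : (forall k, N (p k - c) <= M) ->
  convex_hull p z -> N (z - c) <= M.
Proof.
move=> pM [l [l0 l1] <-]; rewrite convex_hull_sub//.
apply: le_trans (norm_sum normN _ _ _) _; rewrite -[leRHS]mul1r -l1 mulr_suml.
by apply: ler_sum => k _; rewrite norm_scale_ge0// ler_wpM2l.
Qed.

Lemma convex_hull_vertex k : convex_hull p (p k).
Proof.
exists (fun j => (j == k)%:R); first split => [j|]; first exact: ler0n.
  by rewrite (bigD1 k)//= eqxx big1 ?addr0// => j /negbTE->.
by rewrite (bigD1 k)//= eqxx scale1r big1 ?addr0// => j /negbTE->; rewrite scale0r.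
Qed.

(** Distance is convex in each argument, so it is bounded by its values at vertices, one argument at
    a time; an edge attains the bound. *)
Lemma diam_convex_hull c : (forall j k, j != k -> N (p j - p k) = c) ->
  (exists j k, j != k :> 'I_m) -> diam N (convex_hull p) = c.
Proof.
move=> pc [j [k jk]].
have c0 : 0 <= c by rewrite -(pc j k jk) norm_ge0.
have ub : ubound [set N (z.1 - z.2) | z in convex_hull p `*` convex_hull p] c.
  move=> _ [[y z] [/= hy hz] <-]; apply: convex_hull_norm_le hy => i.
  rewrite norm_sub_sym//; apply: convex_hull_norm_le hz => i'.
  by have [->|/pc->//] := eqVneq i' i; rewrite subrr norm0.
apply/le_anti/andP; split.
  apply: ge_sup ub; exists (N (p j - p k)), (p j, p k) => //.
  by split; exact: convex_hull_vertex.
apply: ub_le_sup; first by exists c.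
by exists (p j, p k); [split; exact: convex_hull_vertex|exact: pc].
Qed.

End Hull.

(** A vertex is on the relative boundary because pushing it outwards along [p k] stays in the affine
    subspace but exceeds the section radius [r]. *)
Lemma inscribed_section (R : realType) (n : nat) (N : 'rV[R]_n -> R)
    (U : {vspace 'rV[R]_n}) (r : R) (x a : 'rV[R]_n) (m : nat) (p : 'I_m -> 'rV[R]_n) :
  is_norm N -> 0 < r -> x - a \in U -> ball_section N U 1 r x ->
  (forall k, p k \in U) -> (forall k, N (p k) = r) ->
  inscribed (translate a U) (unit_ball N `&` translate a U) (fun k => x + p k).
Proof.
move=> normN r0 xa xr pU pr.
have pA k : translate a U (x + p k) by apply/translateP; rewrite addrAC memvD.
have p1 k : N (x + p k) <= 1 by apply/(xr _ (pU k)); rewrite pr.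
split => [z hz|k].
  split.
    rewrite /unit_ball/= -[z]subr0.
    by apply: (convex_hull_norm_le normN) hz => k; rewrite subr0.
  case: hz => l [l0 l1] <-; apply/translateP; rewrite convex_hull_sub//.
  by rewrite memv_suml// => k _; rewrite memvZ//; apply/translateP.
split; first by apply: subset_closure; split; [exact: p1|exact: pA].
rewrite /interior/= => intp.
have : nbhs (x + p k) [set v | translate a U v -> unit_ball N v].
  have : within (translate a U) (nbhs (x + p k)) (unit_ball N `&` translate a U).
    by rewrite nbhs_subspace_in.
  apply: (@filterS _ (nbhs (x + p k)) _
    [set v | translate a U v -> (unit_ball N `&` translate a U) v]).
  by move=> v vK vA; case: (vK vA).
have cf : (fun s : R => x + p k + s *: p k) s @[s --> (0 : R)] --> x + p k.
  have xE : x + p k = x + p k + 0 *: p k by rewrite scale0r addr0.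
  rewrite [X in _ --> X]xE.
  by apply: cvgD; [exact: cvg_cst|apply: cvgZr_tmp; exact: cvg_id].
move/cf => /nbhs_ballP[s /= s0 sP].
have s2 : 0 < s / 2 by rewrite divr_gt0.
have : unit_ball N (x + p k + (s / 2) *: p k).
  apply: sP; last by apply/translateP; rewrite addrAC memvD ?memvZ//; apply/translateP.
  by rewrite /ball/= sub0r normrN gtr0_norm//; lra.
rewrite /unit_ball/= -addrA -[X in X + _ *: _]scale1r -scalerDl.
move/(xr _ (memvZ _ (pU k))); rewrite norm_scale_ge0 ?pr; [|by []|by rewrite addr_ge0// ltW].
by rewrite mulrDl mul1r; have := mulr_gt0 s2 r0; lra.
Qed.

(** The homothety sends 0 to [v], so [v] lies in the coset and serves as the centre. *)
Lemma intersection_ball_section (R : realType) (n : nat) (N : 'rV[R]_n -> R)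
    (H : nat -> {vspace 'rV[R]_n}) (i : nat) (x : 'rV[R]_n) :
  is_norm N -> intersection_property N H -> (0 < i < n)%N -> N x <= 1 ->
  exists z rho, [/\ z - x \in H i, 0 <= rho & ball_section N (H i) 1 rho z].
Proof.
move=> normN inter iN Nx.
have [|v [lam [lam0 E]]] := inter i x iN.
  by exists x; split => //; apply/translateP; rewrite subrr mem0v.
have vx : v - x \in H i.
  suff [_ /translateP//] : (unit_ball N `&` translate x (H i)) v.
  rewrite E; exists 0; last by rewrite scaler0 addr0.
  by split; [rewrite /unit_ball/= norm0|exact: mem0v].
exists v, lam; split => // u uU; split=> [vu|ul].
  have : (unit_ball N `&` translate x (H i)) (v + u).
    by split => //; apply/translateP; rewrite addrAC memvD.
  rewrite E => -[y [y1 _] /addrI <-].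
  by rewrite norm_scale_ge0// -[leRHS]mulr1 ler_wpM2l.
suff [] : (unit_ball N `&` translate x (H i)) (v + u) by [].
(* For a single-point section, [N u <= 0] forces [u = 0]; otherwise [u] is divided by [lam]. *)
have [lam_eq0|lam_neq0] := eqVneq lam 0.
  have -> : u = 0.
    by apply: (norm_eq0 normN); apply/le_anti; rewrite norm_ge0// -lam_eq0 ul.
  rewrite E; exists 0; last by rewrite scaler0.
  by split; [rewrite /unit_ball/= norm0|exact: mem0v].
have lam_gt0 : 0 < lam by rewrite lt_neqAle eq_sym lam_neq0.
rewrite E; exists (lam^-1 *: u); last by rewrite scalerA divff// scale1r.
split; last exact: memvZ.
by rewrite /unit_ball/= norm_scale_ge0 ?invr_ge0// ler_pdivrMl// mulr1.
Qed.

Lemma dot_span_eq0 (R : realType) (n : nat) (X : seq 'rV[R]_n) (e u : 'rV[R]_n) :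
  (forall v, v \in X -> dot v e = 0) -> u \in <<X>>%VS -> dot u e = 0.
Proof.
move=> Xe /(coord_span (X := in_tuple X)) ->.
elim/big_ind: _ => [|v w v0 w0|k _]; first by rewrite -(scale0r (0 : 'rV_n)) dotZl mul0r.
  by rewrite dotDl v0 w0 addr0.
by rewrite dotZl Xe ?mulr0// mem_nth.
Qed.

(** * Induction on the dimension of the simplex *)

Section Induction.
Variables (R : realType) (n : nat) (N : 'rV[R]_n -> R).
Variables (H : nat -> {vspace 'rV[R]_n}) (e : nat -> 'rV[R]_n).
Hypotheses (normN : is_norm N) (inter : intersection_property N H).
Hypothesis basis_e : adapted_basis H e.
Hypothesis two_inter : forall i, (1 < i <= n)%N ->
  forall (t : R) (p : 'I_i.-1.+1 -> 'rV[R]_n), 0 < t ->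
    affinely_independent p -> equidistant N p -> diam N (convex_hull p) = 1 ->
    inscribed (translate (t *: e i) (H i.-1))
      (unit_ball N `&` translate (t *: e i) (H i.-1)) p ->
    (unit_ball N `&` vset (flag_ext H i)) `&`
      translate ((2 * t) *: e i) (H i.-1) = set0.
Local Notation V := 'rV[R]_n.

(* Only the points p 0, .., p i are relevant; 0 is their circumcentre. *)
Record centred_simplex (i : nat) (p : nat -> V) (r : R) : Prop := CentredSimplex {
  cs_mem : forall k, (k <= i)%N -> p k \in flag_ext H i;
  cs_norm : forall k, (k <= i)%N -> N (p k) = r;
  cs_dist : forall j k, (j <= i)%N -> (k <= i)%N -> j != k -> N (p j - p k) = 1;
  cs_free : free [seq p k.+1 - p 0%N | k <- iota 0 i];
  cs_gt0 : 0 < r;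
  cs_lt1 : r < 1 }.

Lemma e_orth i j : (0 < i <= n)%N -> (0 < j <= n)%N -> dot (e i) (e j) = (i == j)%:R.
Proof. by case: basis_e => + _; exact. Qed.

Lemma flag_ext_lt i : (i < n)%N -> flag_ext H i = H i.
Proof. by move=> iN; rewrite /flag_ext ltn_eqF. Qed.

Lemma dot_flag i u : (0 < i < n)%N -> u \in H i -> dot u (e i.+1) = 0.
Proof.
move=> /andP[i0 iN]; case: basis_e => _ ->; last by rewrite i0.
apply: dot_span_eq0 => v /mapP[j]; rewrite mem_iota add1n ltnS => /andP[j0 ji] ->.
by rewrite e_orth ?j0 ?(leq_trans ji (ltnW iN))// (ltn_eqF (leq_ltn_trans ji (ltnSn i))).
Qed.

Lemma flag_succ i : (0 < i < n)%N -> (H i + <[e i.+1]> <= flag_ext H i.+1)%VS.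
Proof.
move=> /andP[i0 iN]; rewrite /flag_ext; case: eqP => [_|/eqP iN1]; first exact: subvf.
have iN2 : (i.+1 < n)%N by rewrite ltn_neqAle iN1.
case: basis_e => _ HE; rewrite !HE ?i0 ?iN ?iN2//.
have -> : iota 1 i.+1 = iota 1 i ++ [:: i.+1] by rewrite -[in LHS](addn1 i) iotaD add1n.
by rewrite map_cat span_cat span_seq1 subvv.
Qed.

Lemma centred_simplex1 : (0 < n)%N -> exists p r, centred_simplex 1 p r.
Proof.
move=> n0; have ee : dot (e 1) (e 1) = 1 by rewrite e_orth ?n0//.
have e0 : e 1 != 0.
  apply/eqP => e0; move: ee; rewrite e0 -(scale0r (0 : V)) dotZl mul0r.
  by move=> /esym/eqP; rewrite oner_eq0.
have Ne := norm_gt0 normN e0.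
have eH : e 1 \in flag_ext H 1.
  rewrite /flag_ext; case: eqP => [_|/eqP n1]; first exact: memvf.
  have n2 : (1 < n)%N by rewrite ltn_neqAle n1.
  by case: basis_e => _ ->//=; rewrite memv_span// mem_seq1.
pose w := (N (e 1))^-1 *: e 1.
have Nw : N w = 1 by rewrite norm_scale_ge0 ?invr_ge0 ?(ltW Ne)// mulVf ?gt_eqF.
have wH a : a *: w \in flag_ext H 1 by rewrite !memvZ.
(* The points [w / 2] and [- w / 2] are at distance [N w = 1], with circumradius 1/2. *)
exists (fun k => (if k == 0%N then 1 / 2 else - (1 / 2)) *: w), (1 / 2).
split; [by []| | | |by lra|by lra].
- move=> k _; rewrite norm_scale// Nw mulr1; case: ifP => _.
    by rewrite ger0_norm//; lra.
  by rewrite normrN ger0_norm//; lra.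
- move=> [|[|j]] [|[|k]]// _ _ _ /=; rewrite -scalerBl norm_scale// Nw mulr1.
    by rewrite opprK ger0_norm; lra.
  by rewrite ler0_norm; lra.
- rewrite /= seq1_free -scalerBl scaler_eq0 negb_or; apply/andP.
  split; first by apply/eqP; lra.
  by apply/eqP => w0; move: Nw; rewrite w0 norm0// => /esym/eqP; rewrite oner_eq0.
Qed.

(** The apex [x] is added as a vertex, and everything is translated by [- y] to bring the new
    circumcentre back to 0. *)
Lemma centred_simplexS i p r : (0 < i < n)%N -> centred_simplex i p r ->
  exists q s, centred_simplex i.+1 q s.
Proof.
move=> iN [pH pr pd pf r0 r1]; have /andP[i0 i_lt_n] := iN.
rewrite flag_ext_lt// in pH.
have ee : dot (e i.+1) (e i.+1) = 1 by rewrite e_orth ?eqxx.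
have Ue u : u \in H i -> dot u (e i.+1) = 0 by exact: dot_flag.
have sub y : y \in (H i + <[e i.+1]>)%VS -> y \in flag_ext H i.+1.
  by apply/subvP; exact: flag_succ.
(* If [N (2 *: x) <= 1], the simplex moved by [x] is inscribed in the section at height
   [dot x (e i.+1)], while [2 *: x] is a ball point at twice that height, against the 2-intersection
   property. *)
have two x : x \in (H i + <[e i.+1]>)%VS -> 0 < dot x (e i.+1) ->
    ball_section N (H i) 1 r x -> 1 < N (2 *: x).
  move=> xW hx xr; rewrite ltNge; apply/negP => Nx2.
  pose P (k : 'I_i.+1) := x + p k.
  have xt : x - dot x (e i.+1) *: e i.+1 \in H i.
    move: xW hx {Nx2 xr P} => /memv_addP[u uU [_ /vlineP[a ->] ->]] _.
    by rewrite dotDl dotZl ee (Ue _ uU) add0r mulr1 addrK.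
  have PB (j k : 'I_i.+1) : P j - P k = p j - p k by rewrite opprD addrACA subrr add0r.
  have Pd (j k : 'I_i.+1) : j != k -> N (P j - P k) = 1.
    by move=> jk; rewrite PB pd// -ltnS.
  have P_free : affinely_independent P.
    rewrite /affinely_independent.
    have -> : [seq P (lift ord0 k) - P ord0 | k <- enum 'I_i] =
        [seq p k.+1 - p 0%N | k <- iota 0 i].
      by rewrite -val_enum_ord -map_comp; apply: eq_map => k; rewrite PB lift0.
    exact: pf.
  have P_eq : equidistant N P by exists 1.
  have P_diam : diam N (convex_hull P) = 1.
    apply: (diam_convex_hull normN Pd); exists ord0, ord_max.
    by rewrite -val_eqE/= eq_sym -lt0n.
  have P_ins : inscribed (translate (dot x (e i.+1) *: e i.+1) (H i))
      (unit_ball N `&` translate (dot x (e i.+1) *: e i.+1) (H i)) P.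
    apply: (inscribed_section (p := fun k : 'I_i.+1 => p k) normN r0 xt xr) => k.
      by apply: pH; rewrite -ltnS.
    by apply: pr; rewrite -ltnS.
  have iN1 : (1 < i.+1 <= n)%N by rewrite ltnS i0.
  have E := @two_inter i.+1 iN1 (dot x (e i.+1)) P hx P_free P_eq P_diam P_ins.
  suff : (set0 : set V) (2 *: x) by [].
  rewrite -E; split; last by apply/translateP; rewrite -scalerA -scalerBr memvZ.
  by split=> //; apply: sub; rewrite memvZ.
have [x [y [mu [xW yW hx Hu [Nxy mu0 mu1]]]]] :=
  exists_apex_circumcenter normN ee Ue r0 r1 (pH 0%N (leq0n _)) (pr 0%N (leq0n _))
    (fun x => intersection_ball_section normN inter iN) two.
exists (fun k => if (k <= i)%N then p k - y else x - y), mu; split => //.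
- move=> k _; case: ifP => ki; apply: sub; rewrite memvB//.
  by rewrite (subvP (addvSl (H i) _))// pH.
- move=> k _; case: ifP => // ki.
  by have [] := Hu (p k) (pH k ki) (pr k ki).
- move=> j k; have [ji|ij] := leqP j i; have [ki|ik] := leqP k i => jS kS jk.
  + by rewrite opprB addrA subrK pd.
  + rewrite opprB addrA subrK norm_sub_sym//.
    by have [] := Hu (p j) (pH j ji) (pr j ji).
  + rewrite opprB addrA subrK.
    by have [] := Hu (p k) (pH k ki) (pr k ki).
  + by case/eqP: jk; apply/eqP; rewrite eqn_leq (leq_trans jS ik) (leq_trans kS ij).
have -> : iota 0 i.+1 = iota 0 i ++ [:: i] by rewrite -[in LHS](addn1 i) iotaD.
rewrite map_cat cats1 /= ltnn.
have -> : [seq (if (k.+1 <= i)%N then p k.+1 - y else x - y) - (p 0%N - y) | k <- iota 0 i]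
    = [seq p k.+1 - p 0%N | k <- iota 0 i].
  apply/eq_in_map => k; rewrite mem_iota/= add0n => ->.
  by rewrite opprB addrA subrK.
rewrite opprB addrA subrK.
have /permPl/perm_free-> := perm_rcons (x - p 0%N) [seq p k.+1 - p 0%N | k <- iota 0 i].
rewrite free_cons pf andbT.
(* The new edge [x - p 0] has positive height, while the old edges lie in [H i], at height 0. *)
apply/negP => xp; have := dot_span_eq0 _ xp (e := e i.+1).
rewrite dotBl (Ue _ (pH 0%N (leq0n _))) subr0 => h0; move: hx; rewrite h0 ?ltxx//.
move=> v /mapP[k]; rewrite mem_iota/= add0n => ki ->.
by apply: Ue; rewrite memvB// pH.
Qed.

Lemma exists_centred_simplex i : (0 < i <= n)%N -> exists p r, centred_simplex i p r.
Proof.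
elim: i => // -[_|i IH] /andP[_ iN]; first exact: centred_simplex1.
have [|p [r pr]] := IH; first exact: ltnW.
by apply: centred_simplexS pr.
Qed.

End Induction.

Theorem theorem0p1 (R : realType) (n : nat) (N : 'rV[R]_n -> R)
    (H : nat -> {vspace 'rV[R]_n}) :
  (0 < n)%N ->
  is_norm N ->
  is_flag H ->
  two_intersection_property N H ->
  ((n.+1%:R)%:E <= equilateral_dim N)%E /\
  exists p : 'I_n.+1 -> 'rV[R]_n, equidistant N p.
Proof.
move=> n0 normN _ [inter [e basis_e two]].
have [|p [r [_ _ pd _ _ _]]] := exists_centred_simplex normN inter basis_e two (i := n).
  by rewrite n0 leqnn.
have eqd : equidistant N (fun k : 'I_n.+1 => p k).
  by exists 1 => // j k jk; apply: pd => //; rewrite -ltnS.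
split; last by exists (fun k => p k).
by apply: ereal_sup_ubound; exists n.+1 => //; exists (fun k => p k).
Qed.
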